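(* Fix integers $k\geq 2$, $d\geq 1$ and $1\leq m\leq d$, and fix a real number $\epsilon\in(0,1/2)$. If $F\subseteq\mathbb{R}^d$ does not contain any $(k,\epsilon,\mathbf{v})$-APs for some set of orthogonal unit vectors $\mathbf{v}=\{v_1,\ldots,v_m\}$ in $\mathbb{R}^d$, then \[ \dim_{\mathrm{A}} F\leq \inf_{N\in\mathbb{N}}\frac{\log\left(\lceil\sqrt{d}/\epsilon\rceil^d\, N^{d-m}\, r_{k,m}(N)\right)}{\log\left(N\lceil\sqrt{d}/\epsilon\rceil\right)}. \] In particular (substituting $N=\lceil\sqrt{d}/\epsilon\rceil$), \[ \dim_{\mathrm{A}} F\leq d+\frac{1}{2}\,\frac{\log\left(r_{k,m}(\lceil\sqrt{d}/\epsilon\rceil)/\lceil\sqrt{d}/\epsilon\rceil^m\right)}{\log\lceil\sqrt{d}/\epsilon\rceil}. \]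
   Context: $\mathbb{N}$ is the set of positive integers. Let $\mathbf{v}=\{v_1,\ldots,v_m\}$ be a set of $m$ pairwise orthogonal unit vectors in $\mathbb{R}^d$, $1\le m\le d$. For $k\in\mathbb{N}$ and $\Delta>0$, a set $P\subset\mathbb{R}^d$ is an arithmetic patch of size $k$ and scale $\Delta$ with (respect to) orientation $\mathbf{v}$ if $P=\{t+\Delta\sum_{i=1}^m x_iv_i : x_i=0,1,\ldots,k-1\}$ for some $t\in\mathbb{R}^d$. For $\epsilon\in[0,1/2)$, a set $Q\subset\mathbb{R}^d$ is a $(k,\epsilon,\mathbf{v})$-AP if there is an arithmetic patch $P$ of size $k$ and some scale $\Delta>0$ with orientation $\mathbf{v}$ such that $\sup_{x\in P}\inf_{y\in Q}\|x-y\|\leq\epsilon\Delta$ (Euclidean norm). A set contains a $(k,\epsilon,\mathbf{v})$-AP if some subset of it is a $(k,\epsilon,\mathbf{v})$-AP. $r_{k,m}(N)$ is the largest cardinality of a set $A\subseteq\{1,\ldots,N\}^m$ that does not contain any arithmetic patch of size $k$ (of any scale $\Delta>0$) with orientation $\{e_1,\ldots,e_m\}$, the standard basis of $\mathbb{R}^m$. The Assouad dimension of $F\subseteq\mathbb{R}^d$ is $\dim_{\mathrm{A}}F=\inf\{\sigma\geq0 : \exists C>0\ \forall r>0\ \forall R>r\ \forall x\in F,\ N(B(x,R)\cap F,r)\leq C(R/r)^\sigma\}$, where $B(x,R)$ is the closed ball of radius $R$ centred at $x$ and $N(E,r)$ is the smallest cardinality of a family of sets of diameter at most $r$ covering $E$.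 *)

(* Defs.v *)
From HB Require Import structures.
From mathcomp Require Import all_boot all_order all_algebra.
From mathcomp Require Import all_classical all_reals all_analysis.

Set Implicit Arguments.
Unset Strict Implicit.
Unset Printing Implicit Defensive.

Import Order.TTheory GRing.Theory Num.Theory.
Import numFieldNormedType.Exports.

Local Open Scope classical_set_scope.
Local Open Scope ring_scope.

Section Euclidean.
Variables (R : realType) (d : nat).
Implicit Types (x y : 'rV[R]_d) (E : set 'rV[R]_d).

Definition dotp x y : R := \sum_(i < d) x 0 i * y 0 i.

(* The library norm [`|x|] on ['rV[R]_d] is the sup norm. *)
Definition enorm x : R := Num.sqrt (dotp x x).

Definition orthonormal_family (m : nat) (v : 'I_m -> 'rV[R]_d) : Prop :=
  (forall i, enorm (v i) = 1) /\ (forall i j, i != j -> dotp (v i) (v j) = 0).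

(* Equal to [-oo] on the empty set, which is therefore allowed in covers. *)
Definition ediam E : \bar R :=
  ereal_sup [set (enorm (p.1 - p.2))%:E | p in E `*` E].

Definition coverable_by (n : nat) E (r : R) : Prop :=
  exists U : 'I_n -> set 'rV[R]_d,
    (forall i, (ediam (U i) <= r%:E)%E) /\ E `<=` \bigcup_i U i.

(* Equal to [+oo] when there is no finite cover. *)
Definition covering_number E (r : R) : \bar R :=
  ereal_inf [set n%:R%:E | n in [set n : nat | coverable_by n E r]].

Definition assouad_dim (F : set 'rV[R]_d) : \bar R :=
  ereal_inf [set sigma%:E | sigma in [set sigma : R | 0 <= sigma /\
    exists2 C : R, 0 < C &
      forall r : R, 0 < r -> forall rho : R, r < rho ->
      forall x, F x ->
        (covering_number (closed_ball_ enorm x rho `&` F) r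
         <= (C * (rho / r) `^ sigma)%:E)%E]].

End Euclidean.

Section Patches.
Variables (R : realType) (d m : nat).
Implicit Types (v : 'I_m -> 'rV[R]_d) (P Q F : set 'rV[R]_d).

Definition is_arithmetic_patch (k : nat) (delta : R) v P : Prop :=
  exists t : 'rV[R]_d,
    P = [set t + delta *: \sum_(i < m) (x i)%:R *: v i
        | x in [set: {ffun 'I_m -> 'I_k}]].

Definition is_AP (k : nat) (eps : R) v Q : Prop :=
  exists P (delta : R), [/\ 0 < delta, is_arithmetic_patch k delta v P &
    (ereal_sup [set ereal_inf [set (enorm (x - y))%:E | y in Q] | x in P]
     <= (eps * delta)%:E)%E].

Definition contains_AP (k : nat) (eps : R) v F : Prop :=
  exists2 Q, Q `<=` F & is_AP k eps v Q.

Definition contains_patch (k : nat) v F : Prop :=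
  exists P (delta : R),
    [/\ 0 < delta, is_arithmetic_patch k delta v P & P `<=` F].

End Patches.

Definition std_basis (R : realType) (m : nat) (i : 'I_m) : 'rV[R]_m :=
  delta_mx 0 i.

(* ['I_N] is [{0, ..., N-1}]; shifting by one gives [{1, ..., N}]. *)
Definition grid_point (R : realType) (m N : nat) (a : {ffun 'I_m -> 'I_N}) :
  'rV[R]_m := \row_i (a i).+1%:R.

(* Subsets of [{1, ..., N}^m] are the images of the [A] under the injective map
   [grid_point]; the maximum is over a nonempty family as soon as [0 < k]. *)
Definition patch_free_max (R : realType) (k m N : nat) : nat :=
  \max_(A : {set {ffun 'I_m -> 'I_N}} |
      `[< ~ contains_patch k (@std_basis R m) (@grid_point R m N @` [set` A]) >])
    #|A|.

Definition scale_factor (R : realType) (d : nat) (eps : R) : nat :=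
  `|Num.ceil (Num.sqrt d%:R / eps)|%N.

(* Main.v *)
(** Complete [v] to an orthonormal basis of [R^d] and measure cubes in that
    basis. Cut a cube of side [l] into [(N M)^d] subcubes and write each of
    their indices as [a + M b] with [a] in [{0..M-1}^d] and [b] in [{0..N-1}^d].
    If, for fixed [a] and fixed last [d - m] entries of [b], more than
    [r_{k,m}(N)] subcubes met [F], the first [m] entries of [b] would contain a
    patch of some scale [delta >= 1]; the corresponding corners form a patch of
    scale [delta l / N], and every corner is within
    [sqrt d * l / (N M) <= eps * (l / N)] of [F], so [F] would contain a
    [(k, eps, v)]-AP. Hence at most [M^d N^(d-m) r_{k,m}(N)] subcubes meet [F],
    and iterating this bound down to the desired scale gives the dimension
    estimate. *)
Require Import Defs.
From HB Require Import structures.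
From mathcomp Require Import all_boot all_order all_algebra.
From mathcomp Require Import all_classical all_reals all_analysis.
From mathcomp Require Import ring lra.

Import Order.TTheory GRing.Theory Num.Theory.
Import numFieldNormedType.Exports.

Set Implicit Arguments.
Unset Strict Implicit.

Local Open Scope classical_set_scope.
Local Open Scope ring_scope.

(** * Completing an orthonormal family *)

Section OrthonormalCompletion.
Variables (R : realType) (d : nat).

Lemma dotpE (x y : 'rV[R]_d) : dotp x y = (x *m y^T) 0 0.
Proof. by rewrite mxE; apply: eq_bigr => i _; rewrite mxE. Qed.

Lemma dotp_ge0 (x : 'rV[R]_d) : 0 <= dotp x x.
Proof. by apply: sumr_ge0 => i _; rewrite -expr2 sqr_ge0. Qed.

Lemma dotp_gt0 (x : 'rV[R]_d) : x != 0 -> 0 < dotp x x.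
Proof.
move=> x0; rewrite lt0r dotp_ge0 andbT; apply: contra x0.
rewrite psumr_eq0 => [/allP x0|i _]; last by rewrite -expr2 sqr_ge0.
apply/eqP/rowP => i; rewrite mxE.
by apply/eqP; have := x0 i (mem_index_enum i); rewrite /= mulf_eq0 orbb.
Qed.


(** By rank-nullity the kernel of [V^T] has dimension at least [d - n > 0]; normalise one of its
    nonzero vectors. *)
Lemma exists_unit_orthogonal (n : nat) (V : 'M[R]_(n, d)) : (n < d)%N ->
  exists u : 'rV[R]_d, u *m V^T = 0 /\ u *m u^T = 1%:M.
Proof.
move=> nd; set K := kermx V^T.
have K0 : K != 0.
  rewrite -mxrank_eq0 mxrank_ker mxrank_tr -lt0n subn_gt0.
  exact: leq_ltn_trans (rank_leq_row _) nd.
have [i ri0] : exists i, row i K != 0.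
  apply/existsP; rewrite -negb_forall; apply: contra K0 => /forallP Ki.
  by apply/eqP/row_matrixP => i; rewrite row0; apply/eqP/Ki.
set x := row i K in ri0.
have xV : x *m V^T = 0 by rewrite -row_mul mulmx_ker row0.
have x_gt0 := dotp_gt0 ri0.
exists ((enorm x)^-1 *: x); split; first by rewrite -scalemxAl xV scaler0.
rewrite linearZ /= -scalemxAl -scalemxAr scalerA.
rewrite [x *m _]mx11_scalar -dotpE scale_scalar_mx /enorm -invfM -expr2.
by rewrite sqr_sqrtr ?ltW// mulVf ?gt_eqF.
Qed.

Lemma orthonormal_completion (m e : nat) (V : 'M[R]_(m, d)) :
    (m + e <= d)%N -> V *m V^T = 1%:M ->
  exists U : 'M[R]_(e, d), U *m V^T = 0 /\ U *m U^T = 1%:M.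
Proof.
move=> + VV; elim: e => [|e IH] med.
  by exists 0; split; apply/matrixP => -[].
have [|U [UV UU]] := IH; first by rewrite (leq_trans _ med)// leq_add2l.
have [|u [uX uu]] := @exists_unit_orthogonal _ (col_mx V U).
  by rewrite -addnS.
move: uX; rewrite tr_col_mx mul_mx_row -row_mx0 => /eq_row_mx[uV uU].
rewrite -[e.+1]/(1 + e)%N; exists (col_mx u U); split.
  by rewrite mul_col_mx uV UV col_mx0.
rewrite tr_col_mx mul_col_mx !mul_mx_row uu uU UU.
rewrite -[U in U *m _]trmxK -trmx_mul uU trmx0.
by rewrite -[LHS]/(block_mx 1%:M 0 0 1%:M) -scalar_mx_block.
Qed.

End OrthonormalCompletion.

(** * Cubes in a rotated basis and the Assouad dimension *)

Section Cubes.
Variables (R : realType) (d : nat) (W : 'M[R]_d).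
Hypothesis WW : W *m W^T = 1%:M.
Implicit Types (x y c : 'rV[R]_d) (l : R).

(** The rows of [W] form an orthonormal basis and [y *m W^T] lists the coordinates of [y] in it; [c]
    holds the coordinates of the lowest corner, not the corner itself. *)
Definition cube c l : set 'rV[R]_d :=
  [set y | forall i, c 0 i <= (y *m W^T) 0 i <= c 0 i + l].

Lemma enorm_coord x : enorm (x *m W^T) = enorm x.
Proof.
congr Num.sqrt; rewrite !dotpE trmx_mul trmxK mulmxA -(mulmxA x).
by rewrite (mulmx1C WW) mulmx1.
Qed.

Lemma coord_le_enorm x i : `|(x *m W^T) 0 i| <= enorm x.
Proof.
rewrite -enorm_coord -sqrtr_sqr ler_wsqrtr// /dotp (bigD1 i)//= expr2 lerDl.
by apply: sumr_ge0 => j _; rewrite -expr2 sqr_ge0.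
Qed.

Lemma enorm_le_coord x l : 0 <= l ->
  (forall i, `|(x *m W^T) 0 i| <= l) -> enorm x <= Num.sqrt d%:R * l.
Proof.
move=> l0 xl; rewrite -enorm_coord -[l in leRHS]ger0_norm// -sqrtr_sqr.
rewrite -sqrtrM// ler_wsqrtr// /dotp.
apply: (@le_trans _ _ (\sum_(i < d) l ^+ 2)); last first.
  by rewrite sumr_const card_ord mulr_natl.
by apply: ler_sum => i _; rewrite -expr2 -real_normK ?num_real// ler_sqr.
Qed.

Lemma cube_enorm_le c l x y : 0 <= l -> cube c l x -> cube c l y ->
  enorm (x - y) <= Num.sqrt d%:R * l.
Proof.
move=> l0 xc yc; apply: enorm_le_coord => // i.
move: (xc i) (yc i); rewrite mulmxBl !mxE ler_distl => /andP[? ?] /andP[? ?].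
by apply/andP; split; lra.
Qed.

Lemma ediam_cube_le c l : 0 <= l ->
  (ediam (cube c l) <= (Num.sqrt d%:R * l)%:E)%E.
Proof.
move=> l0; apply: ge_ereal_sup => _ [[x y] [/= xc yc] <-].
by rewrite lee_fin; exact: cube_enorm_le xc yc.
Qed.

Lemma closed_ball_sub_cube x rho :
  closed_ball_ (@enorm R d) x rho `<=` cube (x *m W^T - const_mx rho) (2 * rho).
Proof.
move=> y /= xy i; have := le_trans (coord_le_enorm (x - y) i) xy.
rewrite mulmxBl ler_norml !mxE => /andP[? ?].
by apply/andP; split; lra.
Qed.

Definition covered_by_cubes (E : set 'rV[R]_d) (n : nat) (l : R) : Prop :=
  exists2 s : seq 'rV[R]_d, (size s <= n)%N &
    forall y, E y -> exists2 c, c \in s & cube c l y.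

(** Since [step] holds for every cube at every scale, each of the at most [L ^ n] cubes of one
    generation can be refined into at most [L] cubes of the next. *)
Lemma covered_by_cubes_iter (F : set 'rV[R]_d) (L : nat) (b : R) :
    0 < b ->
    (forall c l, 0 < l -> covered_by_cubes (F `&` cube c l) L (l / b)) ->
  forall n c l, 0 < l -> covered_by_cubes (F `&` cube c l) (L ^ n) (l / b ^+ n).
Proof.
move=> b0 step; elim=> [|n IH] c l l0.
  by exists [:: c] => // y [_ yc]; exists c; rewrite ?inE// expr0 divr1.
have [s sL sP] := IH c l l0.
have ln0 : 0 < l / b ^+ n by rewrite divr_gt0// exprn_gt0.
have /choice[f fP] : forall c', exists s' : seq 'rV[R]_d, (size s' <= L)%N /\
    forall y, (F `&` cube c' (l / b ^+ n)) y ->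
      exists2 c'', c'' \in s' & cube c'' (l / b ^+ n.+1) y.
  move=> c'; have [s' s'L s'P] := step c' _ ln0; exists s'; split => // y.
  by rewrite exprSr invfM mulrA; exact: s'P.
exists (flatten [seq f c' | c' <- s]).
  rewrite size_flatten /shape -map_comp sumnE big_map expnSr.
  apply: (@leq_trans (\sum_(c' <- s) L)); last first.
    by rewrite big_const_seq count_predT iter_addn_0 mulnC leq_mul2r sL orbT.
  by apply: leq_sum => c' _; exact: (fP c').1.
move=> y [Fy yc]; have [c' c's yc'] := sP y (conj Fy yc).
have [c'' c''s yc''] := (fP c').2 y (conj Fy yc').
by exists c'' => //; apply/flatten_mapP; exists c'.
Qed.

Lemma covering_number_le (E : set 'rV[R]_d) n l r :
    0 <= l -> Num.sqrt d%:R * l <= r -> covered_by_cubes E n l ->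
  (covering_number E r <= n%:R%:E)%E.
Proof.
move=> l0 lr [s sn sP]; apply: (@le_trans _ _ (size s)%:R%:E); last first.
  by rewrite lee_fin ler_nat.
apply: ereal_inf_lbound; exists (size s) => //.
exists (fun i => cube (nth 0 s i) l); split.
  by move=> i; apply: le_trans (ediam_cube_le _ l0) _; rewrite lee_fin.
move=> y /sP[c cs yc]; have cs' := cs; rewrite -index_mem in cs'.
by exists (Ordinal cs') => //=; rewrite nth_index.
Qed.

Lemma exists_exp_between (b x : R) : 1 < b -> 1 <= x ->
  exists n, x <= b ^+ n <= b * x.
Proof.
move=> b1 x1; have b0 : 0 < b by rewrite (lt_trans ltr01).
have exn : exists n, x <= b ^+ n.
  have lnb0 : 0 < ln b by rewrite ln_gt0.
  exists (Num.bound (ln x / ln b)).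
  rewrite -ler_ln ?posrE ?exprn_gt0 ?(lt_le_trans ltr01 x1)// lnXn//.
  rewrite -mulr_natl -ler_pdivrMr// ltW// archi_boundP//.
  by rewrite divr_ge0 ?ln_ge0// ltW.
case: (ex_minnP exn) => [[|n] xn nmin]; [exists 0%N|exists n.+1].
  by rewrite xn expr0 /=; nra.
rewrite xn exprS ler_pM2l//=; rewrite leNgt; apply/negP => /ltW /nmin.
by rewrite ltnn.
Qed.

(** The exponent [s] is chosen so that [b] to the power [s] is [L]: after [n] refinements the count
    [L ^ n] is then the [s]-th power of the shrinking factor [b ^+ n], which is comparable to
    [rho / r]. *)
Lemma assouad_dim_le (F : set 'rV[R]_d) (L : nat) (b : R) :
    (0 < d)%N -> 1 < b -> (0 < L)%N ->
    (forall c l, 0 < l -> covered_by_cubes (F `&` cube c l) L (l / b)) ->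
  (assouad_dim F <= (ln L%:R / ln b)%:E)%E.
Proof.
move=> d0 b1 L0 step; have b0 : 0 < b by rewrite (lt_trans ltr01).
have lnb0 : 0 < ln b by rewrite ln_gt0.
have sd1 : 1 <= Num.sqrt d%:R :> R by rewrite -[leLHS]sqrtr1 ler_wsqrtr// ler1n.
set s := ln L%:R / ln b.
have s0 : 0 <= s by rewrite divr_ge0 ?ln_ge0 ?ler1n// ltW.
have bsE : b `^ s = L%:R.
  by rewrite /powR gt_eqF// /s divfK ?gt_eqF// lnK// posrE ltr0n.
apply: ereal_inf_lbound; exists s => //; split => //.
(* A ball of radius [rho] fits in a cube of side [2 * rho], so diameters drop to [r] once [b ^+ n]
   reaches [2 * sqrt d * (rho / r)]. The least such [n] overshoots by at most a factor [b]. *)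
set K := b * (2 * Num.sqrt d%:R).
have K0 : 0 < K by rewrite mulr_gt0// mulr_gt0// (lt_le_trans ltr01).
exists (K `^ s); first exact: powR_gt0.
move=> r r0 rho rrho x Fx; have rho0 : 0 < rho := lt_trans r0 rrho.
have q1 : 1 < rho / r by rewrite ltr_pdivlMr// mul1r.
have [|n /andP[n1 n2]] := @exists_exp_between b (2 * Num.sqrt d%:R * (rho / r)) b1.
  by nra.
have bn0 : 0 < b ^+ n by rewrite exprn_gt0.
have l0 : 0 < 2 * rho by rewrite mulr_gt0.
have [t tn tP] := covered_by_cubes_iter b0 step n (x *m W^T - const_mx rho) l0.
apply: (@le_trans _ _ (L ^ n)%:R%:E); last first.
  rewrite lee_fin natrX -bsE -powR_mulrn ?powR_ge0// -powRrM mulrC powRrM.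
  have q0 : 0 <= rho / r by rewrite ltW// (lt_trans ltr01).
  rewrite powR_mulrn ?(ltW b0)// -powRM ?(ltW K0)//.
  have Kq0 : 0 <= K * (rho / r) by rewrite mulr_ge0 ?(ltW K0).
  by apply: (ge0_ler_powR s0); rewrite ?nnegrE ?(ltW bn0)// /K -mulrA.
apply: (@covering_number_le _ _ (2 * rho / b ^+ n)).
- by rewrite divr_ge0 ?ltW.
- rewrite mulrA ler_pdivrMr//.
  move: n1; rewrite mulrA ler_pdivrMr// => n1; nra.
exists t => // y [yx Fy]; apply: tP; split => //.
exact: closed_ball_sub_cube.
Qed.

End Cubes.

(** * Digits, fibre counting and patches in the integer grid *)

Lemma exists_digit (R : realType) (n : nat) (x : R) :
    (0 < n)%N -> 0 <= x <= n%:R ->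
  exists j : 'I_n, j%:R <= x <= j%:R + 1.
Proof.
case: n => // n _ /andP[x0]; rewrite le_eqVlt => /predU1P[->|xn].
  (* The right endpoint goes to the last unit interval. *)
  by exists ord_max; rewrite -natr1 lerDl ler01 lexx.
have /andP[x1 x2] := truncn_itv x0.
have jn : (Num.truncn x < n.+1)%N by rewrite -(ltr_nat R) (le_lt_trans x1).
by exists (Ordinal jn); rewrite x1 natr1 ltW.
Qed.

Lemma card_fiber_le (S T : finType) (A : {set S * T}) (r : nat) :
  (forall z, #|[set x | (x, z) \in A]%SET| <= r)%N -> (#|A| <= r * #|T|)%N.
Proof.
move=> Ar; rewrite -sum1_card big_mkcond /=.
rewrite (eq_bigr (fun p => if (p.1, p.2) \in A then 1 else 0)%N); last by case.
rewrite -(pair_big predT predT (fun x z => if (x, z) \in A then 1 else 0)%N) /=.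
rewrite exchange_big /= mulnC -sum_nat_const; apply: leq_sum => z _.
by rewrite -big_mkcond sum1dep_card; exact: Ar.
Qed.

Lemma std_patch_pointE (R : realType) (k m : nat) (t : 'rV[R]_m) (delta : R)
    (x : {ffun 'I_m -> 'I_k}) (j : 'I_m) :
  (t + delta *: \sum_(i < m) (x i)%:R *: std_basis R i) 0 j =
  t 0 j + delta * (x j)%:R.
Proof.
rewrite !mxE summxE (bigD1 j)//= !mxE !eqxx mulr1 big1 ?addr0// => i ij.
by rewrite !mxE eqxx eq_sym (negPf ij) mulr0.
Qed.

(** As [k >= 2], the patch contains the points with all [x i = 0] and with all [x i = 1]. Their
    first coordinates differ by [delta], and the shift by one in [grid_point] cancels. *)
Lemma grid_patch_scaleE (R : realType) (k m N : nat) (P : set 'rV[R]_m)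
    (delta : R) (A : set {ffun 'I_m -> 'I_N}) :
    (2 <= k)%N -> (0 < m)%N ->
    is_arithmetic_patch k delta (@std_basis R m) P ->
    P `<=` (@grid_point R m N @` A) ->
  exists a b i, [/\ A a, A b & delta = (b i)%:R - (a i)%:R].
Proof.
move=> k2 m0 [t ->] PA; have k0 : (0 < k)%N by rewrite ltnW.
pose i := Ordinal m0.
have onA (j : 'I_k) : exists2 a, A a & t 0 i + delta * j%:R = (a i).+1%:R.
  have [a Aa /rowP/(_ i)] := PA _ (ex_intro2 _ _ [ffun=> j] I erefl).
  by rewrite std_patch_pointE mxE ffunE => <-; exists a.
have [a Aa] := onA (Ordinal k0); have [b Ab] := onA (Ordinal k2).
rewrite /= mulr0 addr0 mulr1 -!natr1 => tb ta.
by exists a, b, i; split => //; lra.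
Qed.

Lemma grid_patch_scale_ge1 (R : realType) (k m N : nat) (P : set 'rV[R]_m)
    (delta : R) (A : set {ffun 'I_m -> 'I_N}) :
    (2 <= k)%N -> (0 < m)%N -> 0 < delta ->
    is_arithmetic_patch k delta (@std_basis R m) P ->
    P `<=` (@grid_point R m N @` A) -> 1 <= delta.
Proof.
move=> k2 m0 delta0 PP PA.
have [a [b [i [_ _ deltaE]]]] := grid_patch_scaleE k2 m0 PP PA.
move: delta0; rewrite deltaE subr_gt0 ltr_nat => ab.
by rewrite lerBrDl natr1 ler_nat.
Qed.

(** A singleton is patch-free, because a patch inside it would have scale 0. This keeps the
    arguments of the logarithms positive. *)
Lemma patch_free_max_gt0 (R : realType) (k m N : nat) :
  (2 <= k)%N -> (0 < m)%N -> (0 < N)%N -> (0 < patch_free_max R k m N)%N.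
Proof.
move=> k2 m0 N0; pose a : {ffun 'I_m -> 'I_N} := [ffun=> Ordinal N0].
suff : (#|[set a]%SET| <= patch_free_max R k m N)%N by rewrite cards1.
apply: leq_bigmax_cond; apply/asboolP => -[P [delta [delta0 PP PA]]].
have [b [b' [i [/=]]]] := grid_patch_scaleE k2 m0 PP PA.
rewrite !inE => /eqP-> /eqP-> deltaE.
by move: delta0; rewrite deltaE subrr ltxx.
Qed.

(** * One subdivision step *)

Section OneStep.
Variables (R : realType) (k m e N M : nat) (eps : R) (W : 'M[R]_(m + e)).
Variable F : set 'rV[R]_(m + e).
Hypotheses (k2 : (2 <= k)%N) (m0 : (0 < m)%N) (N0 : (0 < N)%N) (M0 : (0 < M)%N).
Hypotheses (eps0 : 0 < eps) (epsM : Num.sqrt (m + e)%:R <= eps * M%:R).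
Hypothesis WW : W *m W^T = 1%:M.
Hypothesis F_AP : ~ contains_AP k eps (fun i => row (lshift e i) W) F.
Variables (c : 'rV[R]_(m + e)) (l : R).
Hypothesis l0 : 0 < l.

Local Notation J := ({ffun 'I_m -> 'I_N} *
  ({ffun 'I_e -> 'I_N} * {ffun 'I_(m + e) -> 'I_M}))%type.

Let side := l / (N * M)%:R.

(** Here [z.2] holds the remainders modulo [M], and [b] and [z.1] the first [m] and last [e]
    quotients. Real values of [b] let the same formula produce the base point of a patch. *)
Definition corner (z : {ffun 'I_e -> 'I_N} * {ffun 'I_(m + e) -> 'I_M})
    (b : 'I_m -> R) : 'rV[R]_(m + e) :=
  \row_i (c 0 i + side * ((z.2 i)%:R + M%:R *
    match fintype.split i with inl j => b j | inr j => (z.1 j)%:R end)).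

Definition subcorner (b : J) := corner b.2 (fun j => (b.1 j)%:R).

Definition subcube (b : J) : set 'rV[R]_(m + e) := cube W (subcorner b) side.

Lemma side_gt0 : 0 < side.
Proof. by rewrite divr_gt0// ltr0n muln_gt0 N0. Qed.

Lemma side_mulE : side * M%:R = l / N%:R.
Proof. by rewrite /side natrM invfM mulrA divfK// pnatr_eq0 -lt0n. Qed.

(** Locate each coordinate in one of [N * M] intervals, then divide the interval's index by [M] with
    remainder. *)
Lemma subcubes_cover y : cube W c l y -> exists b, subcube b y.
Proof.
move=> yc; have NM0 : (0 < N * M)%N by rewrite muln_gt0 N0.
have /choice[f fP] : forall i, exists j : 'I_(N * M),
    c 0 i + side * j%:R <= (y *m W^T) 0 i <= c 0 i + side * j%:R + side.
  move=> i; have /andP[y1 y2] := yc i.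
  have [|j /andP[j1 j2]] :=
    @exists_digit R _ (((y *m W^T) 0 i - c 0 i) / side) NM0.
    rewrite divr_ge0 ?subr_ge0 ?(ltW side_gt0)// ler_pdivrMr ?side_gt0//.
    by rewrite /side mulrC divfK ?pnatr_eq0 -?lt0n// lerBlDl.
  exists j; move: j1 j2; rewrite ler_pdivlMr ?side_gt0// ler_pdivrMr ?side_gt0//.
  by move=> *; apply/andP; split; lra.
have lt_div j : (f j %/ M < N)%N by rewrite ltn_divLR.
have lt_mod j : (f j %% M < M)%N by rewrite ltn_mod.
exists ([ffun j => Ordinal (lt_div (lshift e j))],
  ([ffun j => Ordinal (lt_div (rshift m j))], [ffun j => Ordinal (lt_mod j)])).
move=> i; rewrite mxE ffunE /=.
suff -> : match fintype.split i with
    | inl j => ([ffun j0 => Ordinal (lt_div (lshift e j0))] j)%:R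
    | inr j => ([ffun j0 => Ordinal (lt_div (rshift m j0))] j)%:R
    end = (f i %/ M)%:R :> R.
  rewrite -natrM -natrD (_ : (_ %% _ + _)%N = f i); first exact: fP.
  by rewrite addnC mulnC -divn_eq.
by case: (splitP i) => j ij; rewrite ffunE /=;
  congr (f _ %/ M)%:R; apply: val_inj.
Qed.

(** Adding a multiple of row [i] of [W] changes coordinate [i] only. A quotient step of [delta]
    moves a corner by [side * M * delta = l / N * delta], and the [- 1] undoes the shift in
    [grid_point]. *)
Lemma corner_patch (z : {ffun 'I_e -> 'I_N} * {ffun 'I_(m + e) -> 'I_M})
    (t : 'rV[R]_m) (delta : R) (x : {ffun 'I_m -> 'I_k})
    (a : {ffun 'I_m -> 'I_N}) :
    t + delta *: \sum_(i < m) (x i)%:R *: std_basis R i = grid_point R a ->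
  (corner z (fun j => t 0 j - 1) *m W + (l / N%:R * delta) *:
    \sum_(i < m) (x i)%:R *: row (lshift e i) W) *m W^T =
  corner z (fun j => (a j)%:R).
Proof.
move=> /rowP ta.
have taE j : t 0 j + delta * (x j)%:R = (a j).+1%:R.
  by rewrite -std_patch_pointE ta mxE.
rewrite mulmxDl -mulmxA WW mulmx1 -scalemxAl mulmx_suml.
under eq_bigr do rewrite -scalemxAl -row_mul WW row1.
apply/rowP => i; rewrite !mxE summxE.
case: (splitP i) => j ij.
  have -> : i = lshift e j by apply: val_inj.
  rewrite (bigD1 j)//= !mxE !eqxx mulr1 big1 ?addr0 => [|i' i'j].
    have := taE j; rewrite -natr1 -side_mulE => taj.
    have -> : (a j)%:R = t 0 j + delta * (x j)%:R - 1 :> R by rewrite taj addrK.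
    by ring.
  by rewrite !mxE eqxx eq_shift eq_sym (negPf i'j) mulr0.
have -> : i = rshift m j by apply: val_inj.
rewrite big1 ?mulr0 ?addr0// => i' _.
by rewrite !mxE eqxx eq_shift mulr0.
Qed.

Lemma fiber_patch_free z :
  ~ contains_patch k (@std_basis R m) (@grid_point R m N @`
     [set b | exists2 y, F y & subcube (b, z) y]).
Proof.
move=> [P [delta [delta0 PP PA]]]; apply: F_AP.
have delta1 := grid_patch_scale_ge1 k2 m0 delta0 PP PA.
(* All of [F] serves as the approximating set. *)
have [t PE] := PP; exists F => //.
have N0' : 0 < N%:R :> R by rewrite ltr0n.
have M0' : 0 < M%:R :> R by rewrite ltr0n.
eexists; exists (l / N%:R * delta); split.
- by rewrite mulr_gt0// divr_gt0.
- by exists (corner z (fun j => t 0 j - 1) *m W).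
apply: ge_ereal_sup => _ [_ [x _ <-] <-].
have [|a [y Fy ya] ax] := PA (t + delta *: \sum_(i < m) (x i)%:R *: std_basis R i).
  by rewrite PE; exists x.
set p := _ + _.
have pE : p *m W^T = corner z (fun j => (a j)%:R) by apply: corner_patch.
apply: (@le_trans _ _ (enorm (p - y))%:E).
  by apply: ereal_inf_lbound; exists y.
rewrite lee_fin; apply: (@le_trans _ _ (Num.sqrt (m + e)%:R * side)).
  (* The patch point [p] is the lowest corner of a subcube containing [y]. *)
  apply: (cube_enorm_le WW (ltW side_gt0) _ ya) => i.
  by rewrite pE lexx lerDl ltW// side_gt0.
(* [eps * M * side] equals [eps * (l / N)], which [delta >= 1] bounds by [eps] times the scale of
   the patch. *)
apply: (@le_trans _ _ (eps * M%:R * side)); first by rewrite ler_pM2r// side_gt0.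
by rewrite -mulrA ler_pM2l// [_ * side]mulrC side_mulE ler_peMr// ltW// divr_gt0.
Qed.

(** There are [M ^ (m + e) * N ^ e] values of [z]; over each, the subcubes meeting [F] have a
    patch-free set of indices. *)
Lemma covered_by_subcubes :
  covered_by_cubes W (F `&` cube W c l)
    (M ^ (m + e) * N ^ e * patch_free_max R k m N)%N side.
Proof.
pose A := [set b : J | `[< exists2 y, F y & subcube b y >]]%SET.
exists [seq subcorner b | b <- enum A].
  rewrite size_map -cardE [leqRHS]mulnC.
  have -> : (M ^ (m + e) * N ^ e =
      #|{: {ffun 'I_e -> 'I_N} * {ffun 'I_(m + e) -> 'I_M}}|)%N.
    by rewrite card_prod !card_ffun !card_ord mulnC.
  apply: card_fiber_le => z; apply: leq_bigmax_cond; apply/asboolP.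
  rewrite (_ : [set` _] = [set b | exists2 y, F y & subcube (b, z) y]).
    exact: fiber_patch_free.
  by apply/seteqP; split => b /=; rewrite !inE.
move=> y [Fy /subcubes_cover[b yb]]; exists (subcorner b) => //.
by apply: map_f; rewrite mem_enum inE; apply/asboolP; exists y.
Qed.

End OneStep.

(** * The scale factor and the final estimates *)

Lemma sqrt_le_scale_factor (R : realType) (d : nat) (eps : R) : 0 < eps ->
  Num.sqrt d%:R <= eps * (scale_factor d eps)%:R.
Proof.
move=> eps0; rewrite mulrC -ler_pdivrMr// /scale_factor natr_absz ger0_norm.
  exact: ceil_ge.
by rewrite ceil_ge0 (lt_le_trans (ltrN10 R))// divr_ge0 ?sqrtr_ge0// ltW.
Qed.

Lemma scale_factor_gt1 (R : realType) (d : nat) (eps : R) :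
  (0 < d)%N -> 0 < eps < 1 / 2 -> (1 < scale_factor d eps)%N.
Proof.
move=> d0 /andP[eps0 eps1]; rewrite -(ltr_nat R).
have sd1 : 1 <= Num.sqrt d%:R :> R by rewrite -[leLHS]sqrtr1 ler_wsqrtr// ler1n.
have := sqrt_le_scale_factor d eps0.
move: (scale_factor _ _)%:R => M; nra.
Qed.

Lemma assouad_dim_le_patch_free (R : realType) (k d m N : nat) (eps : R)
    (F : set 'rV[R]_d) (v : 'I_m -> 'rV[R]_d) :
    (2 <= k)%N -> (0 < m <= d)%N -> 0 < eps < 1 / 2 -> orthonormal_family v ->
    ~ contains_AP k eps v F -> (0 < N)%N ->
  (assouad_dim F <=
    (ln (scale_factor d eps ^ d * N ^ (d - m) * patch_free_max R k m N)%N%:R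
     / ln (N * scale_factor d eps)%N%:R)%:E)%E.
Proof.
move=> k2 /andP[m0 md] /[dup] eps01 /andP[eps0 _] [v1 vv] FAP N0.
set M := scale_factor d eps.
have d0 : (0 < d)%N := leq_trans m0 md.
have M1 : (1 < M)%N := scale_factor_gt1 d0 eps01.
have epsM : Num.sqrt d%:R <= eps * M%:R := sqrt_le_scale_factor d eps0.
pose V := \matrix_(i < m) v i.
have VV : V *m V^T = 1%:M.
  apply/matrixP => i j; rewrite mxE [RHS]mxE.
  rewrite (_ : \sum_j0 _ = dotp (v i) (v j)); last first.
    by apply: eq_bigr => h _; rewrite !mxE.
  have [<-|/vv//] := eqVneq i j.
  by rewrite -(sqr_sqrtr (dotp_ge0 (v i))) -/(enorm _) v1 expr1n.
(* From here on [M] is known only through [M1] and [epsM], and [d] can be replaced by [m + e]. *)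
clearbody M; have [e de] : exists e, d = (m + e)%N by exists (d - m)%N; rewrite subnKC.
subst d; have [U [UV UU]] := orthonormal_completion (leqnn _) VV.
pose W := col_mx V U.
have WW : W *m W^T = 1%:M.
  rewrite tr_col_mx mul_col_mx !mul_mx_row VV UV UU.
  have -> : V *m U^T = 0 by rewrite -[LHS]trmxK trmx_mul trmxK UV trmx0.
  by rewrite -[LHS]/(block_mx 1%:M 0 0 1%:M) -scalar_mx_block.
have vE : v = (fun i => row (lshift e i) W).
  by apply/funext => i; rewrite rowKu rowK.
rewrite vE in FAP; rewrite addKn.
have M0 : (0 < M)%N := ltnW M1.
apply: (assouad_dim_le WW) => //.
- by rewrite ltr1n (leq_trans M1)// leq_pmull.
- by rewrite !muln_gt0 !expn_gt0 M0 N0 patch_free_max_gt0.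
by move=> c l l0; apply: (covered_by_subcubes k2 _ _ _ eps0 epsM WW FAP).
Qed.

Theorem theorem2p1 (R : realType) (k d m : nat) (eps : R)
  (hk : (2 <= k)%N) (hd : (1 <= d)%N) (hm : (1 <= m <= d)%N)
  (heps : 0 < eps < 1 / 2)
  (F : set 'rV[R]_d) (v : 'I_m -> 'rV[R]_d)
  (hv : orthonormal_family v)
  (hF : ~ contains_AP k eps v F) :
  let M := scale_factor d eps in
  (assouad_dim F <=
     ereal_inf [set (ln ((M ^ d * N ^ (d - m) * patch_free_max R k m N)%N%:R : R)
                     / ln ((N * M)%N%:R : R))%:E
               | N in [set N : nat | (1 <= N)%N]])%E
  /\
  (assouad_dim F <=
     (d%:R + 1 / 2 * (ln ((patch_free_max R k m M)%:R / M%:R ^+ m : R)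
                      / ln (M%:R : R)))%:E)%E.
Proof.
have main := assouad_dim_le_patch_free hk hm heps hv hF.
move=> M; split; first by apply: le_ereal_inf_tmp => _ [N /= N0 <-]; exact: main.
have M1 : (1 < M)%N := scale_factor_gt1 hd heps.
have M0 : (0 < M)%N := ltnW M1.
have /andP[m0 md] := hm.
(* Take [N = M]: the denominator becomes [2 * ln M], and the two sides turn out to be equal. *)
apply: le_trans (main _ M0) _; rewrite lee_fin -/M.
have M0R : 0 < M%:R :> R by rewrite ltr0n.
have r0 : 0 < (patch_free_max R k m M)%:R :> R by rewrite ltr0n patch_free_max_gt0.
have lnM0 : 0 < ln (M%:R : R) by rewrite ln_gt0// ltr1n.
rewrite !natrM !natrX ln_div ?posrE ?exprn_gt0// !lnM ?posrE ?mulr_gt0 ?exprn_gt0//.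
have lnX n : ln (M%:R ^+ n) = n%:R * ln M%:R :> R by rewrite lnXn// mulr_natl.
rewrite !lnX natrB// le_eqVlt; apply/orP; left; apply/eqP.
by field; rewrite !gt_eqF ?addr_gt0.
Qed.
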